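(* Let $T$ be a path tetrahedron and let $\Sigma_T$ be its dihedral angle sum. Then $$2\pi < \Sigma_T < 2.5\,\pi,$$ and each value in the open interval $(2\pi, 2.5\,\pi)$ is attained as $\Sigma_T$ for some path tetrahedron $T$.
   Context: A tetrahedron is the convex hull of four points in $\mathbb{R}^3$ not lying in the same plane. The six interior angles between its faces are called its dihedral angles (each dihedral angle is associated with one of the six edges). The dihedral angle sum $\Sigma_T$ of a tetrahedron $T$ is the sum of all its six dihedral angles (in radians). A tetrahedron is called a path tetrahedron if it has three mutually orthogonal edges that do not intersect at a single point. *)

(* Defs.v *)
(* MathComp-Analysis, over an arbitrary R : realType. *)
From HB Require Import structures.
From mathcomp Require Import all_boot all_order all_algebra.
From mathcomp Require Import all_classical all_reals all_analysis.

Set Implicit Arguments.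
Unset Strict Implicit.
Unset Printing Implicit Defensive.

Import Order.TTheory GRing.Theory Num.Theory.

Local Open Scope ring_scope.
Local Open Scope classical_set_scope.

(* MathComp-Analysis equips 'rV[R]_3 with the sup norm, hence the explicit
   Euclidean inner product and norm. *)
Definition dot (R : realType) (u v : 'rV[R]_3) : R :=
  \sum_(i < 3) u 0 i * v 0 i.

Definition euclidean_norm (R : realType) (u : 'rV[R]_3) : R :=
  Num.sqrt (dot u u).

Definition vector_angle (R : realType) (u v : 'rV[R]_3) : R :=
  acos (dot u v / (euclidean_norm u * euclidean_norm v)).

Definition coplanar (R : realType) (v : 'I_4 -> 'rV[R]_3) : Prop :=
  exists (n : 'rV[R]_3) (c : R), n != 0 /\ forall i, dot n (v i) = c.

(* A tetrahedron is the convex hull of its vertices and is determined by them;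
   the numbering of the vertices is immaterial to everything below. *)
Record tetrahedron (R : realType) : Type := Tetrahedron {
  vertex :> 'I_4 -> 'rV[R]_3 ;
  vertex_noncoplanar : ~ coplanar vertex
}.

(* An edge is named by the indices i < j of its endpoints. *)
Definition is_edge (e : 'I_4 * 'I_4) : bool := (e.1 < e.2)%N.

Definition edge_vector (R : realType) (T : tetrahedron R) (e : 'I_4 * 'I_4)
    : 'rV[R]_3 :=
  T e.2 - T e.1.

Definition edge_segment (R : realType) (T : tetrahedron R) (e : 'I_4 * 'I_4)
    : set 'rV[R]_3 :=
  [set p | exists t : R, 0 <= t <= 1 /\ p = (1 - t) *: T e.1 + t *: T e.2].

(* The component of u orthogonal to d. *)
Definition orthogonal_part (R : realType) (d u : 'rV[R]_3) : 'rV[R]_3 :=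
  u - (dot u d / dot d d) *: d.

(* For {i, j, k, l} = {0, 1, 2, 3}: the interior angle along the edge ij between
   the faces ijk and ijl, i.e. the angle between the two rays that are
   perpendicular to the line ij and point into the half-planes bounded by that
   line which contain the third vertices of these faces. *)
Definition dihedral_angle (R : realType) (T : tetrahedron R) (i j k l : 'I_4)
    : R :=
  vector_angle (orthogonal_part (T j - T i) (T k - T i))
               (orthogonal_part (T j - T i) (T l - T i)).

Definition dihedral_angle_sum (R : realType) (T : tetrahedron R) : R :=
  dihedral_angle T 0 1 2 3 + dihedral_angle T 0 2 1 3 +
  dihedral_angle T 0 3 1 2 + dihedral_angle T 1 2 0 3 +
  dihedral_angle T 1 3 0 2 + dihedral_angle T 2 3 0 1.

(* Edges have nonzero direction, so mutually orthogonal edges are distinct. *)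
Definition path_tetrahedron (R : realType) (T : tetrahedron R) : Prop :=
  exists e1 e2 e3 : 'I_4 * 'I_4,
    [/\ is_edge e1, is_edge e2 & is_edge e3] /\
    [/\ dot (edge_vector T e1) (edge_vector T e2) = 0,
        dot (edge_vector T e1) (edge_vector T e3) = 0 &
        dot (edge_vector T e2) (edge_vector T e3) = 0] /\
    edge_segment T e1 `&` edge_segment T e2 `&` edge_segment T e3 = set0.

(* Main.v *)
Require Import Defs.
From mathcomp Require Import all_boot all_order all_algebra.
From mathcomp Require Import all_classical all_reals all_analysis.
From mathcomp Require Import ring lra.

Set Implicit Arguments.
Unset Strict Implicit.
Unset Printing Implicit Defensive.

Import Order.TTheory GRing.Theory Num.Theory.
Import numFieldNormedType.Exports.

Local Open Scope ring_scope.

(** Let A, B, C, D be the vertices of the tetrahedron in the order of the path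
    formed by its three orthogonal edges u = B - A, v = C - B, w = D - C, and
    let p, q, r be the squared lengths of u, v, w.  The inner products of u, v,
    w determine everything: the dihedral angles at AC, BC and BD are right, and
    the angles a at CD, b at AB, c at AD are acute with
      cos^2 a = q / (p + q),   cos^2 b = q / (q + r),
      cos^2 c = p r / ((p + q) (q + r)),
    so that cos c = sin a sin b ([orthogonal_path_angle_sum]).

    The sum is therefore 3 pi / 2 + (a + b + c), and the bounds say that
    a + b + c lies strictly between pi / 2 and pi: indeed
    cos c < sin a = cos (pi / 2 - a) gives pi / 2 - a < c, and
    cos c > sin a sin b - cos a cos b = cos (pi - (a + b)) gives
    c < pi - (a + b) ([orthoscheme_angle_bounds]).

    Three distinct edges of a tetrahedron share a vertex, or form a triangle,
    or form a path ([three_edges]).  Segments with a common endpoint have a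
    common point, and a triangle cannot have three right angles, so the
    orthogonal edges in the definition form a path
    ([path_tetrahedronP]).  Relabelling the vertices along that path leaves the
    angle sum unchanged ([dihedral_angle_sum_perm]).

    Conversely, legs sin t, cos t, sin t produce a = b = t and
    cos c = sin^2 t; the equation 2 t + c = s is solved for t by the
    intermediate value theorem ([orthoscheme_angle_attained]). *)

(** * The Euclidean inner product *)

Lemma dotC (R : realType) (u v : 'rV[R]_3) : dot u v = dot v u.
Proof. by apply: eq_bigr => i _; rewrite mulrC. Qed.

Lemma dotDl (R : realType) (u v w : 'rV[R]_3) :
  dot (u + v) w = dot u w + dot v w.
Proof. by rewrite /dot -big_split; apply: eq_bigr => i _; rewrite mxE mulrDl. Qed.

Lemma dotZl (R : realType) (a : R) (u v : 'rV[R]_3) :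
  dot (a *: u) v = a * dot u v.
Proof. by rewrite /dot mulr_sumr; apply: eq_bigr => i _; rewrite mxE mulrA. Qed.

Lemma dotNl (R : realType) (u v : 'rV[R]_3) : dot (- u) v = - dot u v.
Proof. by rewrite -scaleN1r dotZl mulN1r. Qed.

Lemma dotDr (R : realType) (u v w : 'rV[R]_3) :
  dot u (v + w) = dot u v + dot u w.
Proof. by rewrite dotC dotDl !(dotC _ u). Qed.

Lemma dotZr (R : realType) (a : R) (u v : 'rV[R]_3) :
  dot u (a *: v) = a * dot u v.
Proof. by rewrite dotC dotZl dotC. Qed.

Lemma dotNr (R : realType) (u v : 'rV[R]_3) : dot u (- v) = - dot u v.
Proof. by rewrite dotC dotNl dotC. Qed.

Definition dot_linear (R : realType) :=
  (@dotDl R, @dotDr R, @dotNl R, @dotNr R, @dotZl R, @dotZr R).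

Lemma dot_ge0 (R : realType) (u : 'rV[R]_3) : 0 <= dot u u.
Proof. by apply: sumr_ge0 => i _; rewrite -expr2 sqr_ge0. Qed.

Lemma dot_eq0 (R : realType) (u : 'rV[R]_3) : (dot u u == 0) = (u == 0).
Proof.
apply/eqP/eqP => [u0|->]; last by rewrite /dot big1 // => i _; rewrite mxE mul0r.
apply/rowP => i; rewrite mxE; apply/eqP; rewrite -sqrf_eq0 expr2; apply/eqP.
by move: i isT; apply: psumr_eq0P u0 => i _; rewrite -expr2 sqr_ge0.
Qed.

Lemma dot_gt0 (R : realType) (u : 'rV[R]_3) : u != 0 -> 0 < dot u u.
Proof. by move=> u0; rewrite lt_neqAle dot_ge0 eq_sym dot_eq0 u0. Qed.

(** * Dihedral angles *)

(** The dihedral angle as a function of points, so that it can be rewritten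
    without reference to a tetrahedron or its labelling. *)
Definition dihedral (R : realType) (A B C D : 'rV[R]_3) : R :=
  vector_angle (orthogonal_part (B - A) (C - A))
               (orthogonal_part (B - A) (D - A)).

Definition angle_sum (R : realType) (A B C D : 'rV[R]_3) : R :=
  dihedral A B C D + dihedral A C B D + dihedral A D B C +
  dihedral B C A D + dihedral B D A C + dihedral C D A B.

Lemma dihedral_swap_faces (R : realType) (A B C D : 'rV[R]_3) :
  dihedral A B C D = dihedral A B D C.
Proof. by rewrite /dihedral /vector_angle dotC mulrC [X in _ / X]mulrC mulrC. Qed.

(** Replacing the base point A by B changes C - A by a multiple of the direction
    of the line AB, which the projection orthogonal to that line kills. *)
Lemma orthogonal_part_swap (R : realType) (A B C : 'rV[R]_3) :
  orthogonal_part (A - B) (C - B) = orthogonal_part (B - A) (C - A).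
Proof.
rewrite -(opprB B A); have -> : C - B = (C - A) - (B - A).
  by rewrite opprB addrA subrK.
move: (B - A) (C - A) => d x; have [->|d0] := eqVneq d 0.
  by rewrite oppr0 addr0.
have coeff : dot (x - d) (- d) / dot (- d) (- d) = 1 - dot x d / dot d d.
  by rewrite !dot_linear; field; rewrite dot_eq0.
by rewrite /orthogonal_part coeff scalerN opprK scalerBl scale1r addrA subrK.
Qed.

Lemma dihedral_swap_edge (R : realType) (A B C D : 'rV[R]_3) :
  dihedral A B C D = dihedral B A C D.
Proof. by rewrite /dihedral !(orthogonal_part_swap B A). Qed.

Lemma angle_sum_swap01 (R : realType) (A B C D : 'rV[R]_3) :
  angle_sum A B C D = angle_sum B A C D.
Proof.
rewrite /angle_sum (dihedral_swap_edge A B) (dihedral_swap_faces C D A B).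
by rewrite [LHS](+%R.[ACl 1*4*5*2*3*6]).
Qed.

Lemma angle_sum_swap12 (R : realType) (A B C D : 'rV[R]_3) :
  angle_sum A B C D = angle_sum A C B D.
Proof.
rewrite /angle_sum (dihedral_swap_edge B C) (dihedral_swap_faces A D B C).
by rewrite [LHS](+%R.[ACl 2*1*3*4*6*5]).
Qed.

Lemma angle_sum_swap23 (R : realType) (A B C D : 'rV[R]_3) :
  angle_sum A B C D = angle_sum A B D C.
Proof.
rewrite /angle_sum (dihedral_swap_edge C D) (dihedral_swap_faces A B C D).
by rewrite [LHS](+%R.[ACl 1*3*2*5*4*6]).
Qed.

Lemma dot_orthogonal_part (R : realType) (d x y : 'rV[R]_3) : d != 0 ->
  dot (orthogonal_part d x) (orthogonal_part d y) =
  dot x y - dot x d * dot y d / dot d d.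
Proof.
rewrite -dot_eq0 => d0; rewrite /orthogonal_part !dot_linear (dotC d y).
by field.
Qed.

(** With the norms absorbed under one square root, the cosine is the square root
    of a rational function of inner products, which field arithmetic can
    simplify. *)
Lemma vector_angle_acute (R : realType) (u v : 'rV[R]_3) : 0 <= dot u v ->
  vector_angle u v = acos (Num.sqrt (dot u v ^+ 2 / (dot u u * dot v v))).
Proof.
move=> uv; rewrite /vector_angle /euclidean_norm -sqrtrM ?dot_ge0 //.
rewrite [in RHS]sqrtrM ?sqr_ge0 // sqrtr_sqr ger0_norm // sqrtrV //.
by rewrite mulr_ge0 ?dot_ge0.
Qed.

(** The Gram entries a, b, c of the projections are separate arguments so that they
    are simplified before dividing by them. *)
Lemma dihedral_acute (R : realType) (A B C D d x y : 'rV[R]_3) (a b c g : R) :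
  B - A = d -> C - A = x -> D - A = y -> d != 0 ->
  dot x y - dot x d * dot y d / dot d d = a ->
  dot x x - dot x d * dot x d / dot d d = b ->
  dot y y - dot y d * dot y d / dot d d = c ->
  0 <= a -> a ^+ 2 / (b * c) = g ->
  dihedral A B C D = acos (Num.sqrt g).
Proof.
move=> Ed Ex Ey d0 Ea Eb Ec a0 <-; rewrite /dihedral Ed Ex Ey.
by rewrite vector_angle_acute dot_orthogonal_part ?Ea // !dot_orthogonal_part
  ?Eb ?Ec.
Qed.

Lemma dihedral_right (R : realType) (A B C D d x y : 'rV[R]_3) :
  B - A = d -> C - A = x -> D - A = y -> d != 0 ->
  dot x y - dot x d * dot y d / dot d d = 0 ->
  dihedral A B C D = pi / 2.
Proof.
move=> Ed Ex Ey d0 xy0; rewrite /dihedral Ed Ex Ey /vector_angle.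
by rewrite dot_orthogonal_part // xy0 mul0r acos0.
Qed.

(** The angle at each edge is read off from the inner products of the projections
    of the two other vertices along that edge, all of which are rational in
    p, q, r. *)
Lemma orthogonal_path_angle_sum (R : realType) (A B C D u v w : 'rV[R]_3) :
  B - A = u -> C - B = v -> D - C = w -> u != 0 -> v != 0 -> w != 0 ->
  dot u v = 0 -> dot u w = 0 -> dot v w = 0 ->
  let p := dot u u in let q := dot v v in let r := dot w w in
  angle_sum A B C D =
  3 / 2 * pi + acos (Num.sqrt (q / (p + q))) + acos (Num.sqrt (q / (q + r))) +
  acos (Num.sqrt (p / (p + q) * (r / (q + r)))).
Proof.
move=> Eu Ev Ew u0 v0 w0 uv uw vw p q r.
have [vu wu wv] : [/\ dot v u = 0, dot w u = 0 & dot w v = 0].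
  by rewrite !(dotC _ u) (dotC w).
have p0 : 0 < p := dot_gt0 u0; have q0 : 0 < q := dot_gt0 v0.
have r0 : 0 < r := dot_gt0 w0.
have CA : C - A = u + v by rewrite -Eu -Ev [RHS]addrC subrKA.
have DB : D - B = v + w by rewrite -Ew -Ev [RHS]addrC subrKA.
have DA : D - A = u + v + w by rewrite -CA -Ew [RHS]addrC subrKA.
have AB : A - B = - u by rewrite -Eu opprB.
have BC : B - C = - v by rewrite -Ev opprB.
have AC : A - C = - (u + v) by rewrite -CA opprB.
have dots := (dot_linear, uv, uw, vw, vu, wu, wv, add0r, addr0, oppr0).
have uv0 : u + v != 0.
  by rewrite -dot_eq0 !dots; apply: lt0r_neq0; apply: addr_gt0.
have vw0 : v + w != 0.
  by rewrite -dot_eq0 !dots; apply: lt0r_neq0; apply: addr_gt0.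
have uvw0 : u + v + w != 0.
  by rewrite -dot_eq0 !dots; apply: lt0r_neq0; rewrite !addr_gt0.
have [[pn0 qn0] rn0] := (lt0r_neq0 p0, lt0r_neq0 q0, lt0r_neq0 r0).
have [pq0 qr0] := (lt0r_neq0 (addr_gt0 p0 q0), lt0r_neq0 (addr_gt0 q0 r0)).
have pqr0 := lt0r_neq0 (addr_gt0 (addr_gt0 p0 q0) r0).
have eAB : dihedral A B C D = acos (Num.sqrt (q / (q + r))).
  apply: (dihedral_acute (a := q) (b := q) (c := q + r) Eu CA DA) => //.
  - by rewrite !dots -/p -/q -/r; field.
  - by rewrite !dots -/p -/q -/r; field.
  - by rewrite !dots -/p -/q -/r; field.
  - exact: ltW.
  - by field; rewrite qr0 qn0.
have eCD : dihedral C D A B = acos (Num.sqrt (q / (p + q))).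
  apply: (dihedral_acute (a := q) (b := p + q) (c := q) Ew AC BC) => //.
  - by rewrite !dots -/p -/q -/r; field.
  - by rewrite !dots -/p -/q -/r; field.
  - by rewrite !dots -/p -/q -/r; field.
  - exact: ltW.
  - by field; rewrite pq0 qn0.
(* With d = u + v + w, dot u u - (dot u d)^2 / dot d d = p - p^2 / (p + q + r),
   and similarly for u + v. *)
have eAD : dihedral A D B C =
           acos (Num.sqrt (p / (p + q) * (r / (q + r)))).
  apply: (dihedral_acute (a := p * r / (p + q + r))
    (b := p * (q + r) / (p + q + r)) (c := (p + q) * r / (p + q + r))
    DA Eu CA) => //.
  - by rewrite !dots -/p -/q -/r; field.
  - by rewrite !dots -/p -/q -/r; field.
  - by rewrite !dots -/p -/q -/r; field.
  - by rewrite ltW // divr_gt0 ?mulr_gt0 ?addr_gt0.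
  - by field; rewrite qr0 pq0 pqr0 rn0 pn0.
have eAC : dihedral A C B D = pi / 2.
  by apply: (dihedral_right CA Eu DA) => //; rewrite !dots -/p -/q -/r; field.
have eBC : dihedral B C A D = pi / 2.
  by apply: (dihedral_right Ev AB DB) => //; rewrite !dots -/p -/q -/r; field.
have eBD : dihedral B D A C = pi / 2.
  by apply: (dihedral_right DB AB Ev) => //; rewrite !dots -/p -/q -/r; field.
rewrite /angle_sum eAB eCD eAD eAC eBC eBD.
by field.
Qed.

(** * Bounds for the angle sum of an orthogonal path *)

(** Both inequalities compare cosines of angles between 0 and pi, where the
    cosine decreases: sin a sin b < sin a for the lower bound, and
    cos a cos b > 0 for the upper one. *)
Lemma orthoscheme_angle_bounds (R : realType) (a b : R) :
  0 < a < pi / 2 -> 0 < b < pi / 2 ->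
  pi / 2 < a + b + acos (sin a * sin b) < pi.
Proof.
move=> ha hb; have [/andP[a0 a1] /andP[b0 b1]] := (ha, hb).
have sa := sin_gt0_pihalf ha; have sb := sin_gt0_pihalf hb.
have ca : 0 < cos a by apply: cos_gt0_pihalf; lra.
have cb : 0 < cos b by apply: cos_gt0_pihalf; lra.
have sb1 : sin b < 1 by have := cos2Dsin2 b; nra.
have st : -1 <= sin a * sin b <= 1.
  by have := sin_le1 a; nra.
have cg := acosK (x := sin a * sin b); rewrite in_itv /= in cg.
have {}cg := cg st.
have gpi : acos (sin a * sin b) \in `[0, pi].
  by rewrite in_itv /= acos_ge0 // acos_lepi.
have low : pi / 2 - a < acos (sin a * sin b).
  rewrite -ltr_cos //; last by rewrite in_itv /=; lra.
  by rewrite cg -opprB cosN cosBpihalf; nra.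
have up : acos (sin a * sin b) < pi - (a + b).
  rewrite -ltr_cos //; last by rewrite in_itv /=; lra.
  rewrite cg addrC cosDpi cosN cosD; nra.
lra.
Qed.

Lemma acos_sqrt_ratio (R : realType) (p q : R) : 0 < p -> 0 < q ->
  0 < acos (Num.sqrt (q / (p + q))) < pi / 2 /\
  sin (acos (Num.sqrt (q / (p + q)))) = Num.sqrt (p / (p + q)).
Proof.
move=> p0 q0; set c := Num.sqrt _.
have pq0 : 0 < p + q by exact: addr_gt0.
have ratio0 : 0 < q / (p + q) by exact: divr_gt0.
have c0 : 0 < c by rewrite sqrtr_gt0.
have c2 : c ^+ 2 = q / (p + q) by rewrite sqr_sqrtr // ltW.
have c2p : 1 - c ^+ 2 = p / (p + q) by rewrite c2; field; exact: lt0r_neq0.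
have c1 : c < 1 by have := divr_gt0 p0 pq0; rewrite -c2p; nra.
have cB : -1 <= c <= 1 by lra.
split; last by rewrite sin_acos // c2p.
rewrite acos_gt0 /=; last lra.
rewrite -ltr_cos ?in_itv /= ?acos_ge0 ?acos_lepi //; last first.
  by have := pi_gt0 R; lra.
by rewrite cos_pihalf acosK // in_itv.
Qed.

Lemma orthogonal_path_angle_sum_bounds (R : realType)
    (A B C D : 'rV[R]_3) :
  A != B -> B != C -> C != D -> dot (B - A) (C - B) = 0 ->
  dot (B - A) (D - C) = 0 -> dot (C - B) (D - C) = 0 ->
  2 * pi < angle_sum A B C D < 5 / 2 * pi.
Proof.
move=> AB BC CD uv uw vw.
have u0 : B - A != 0 by rewrite subr_eq0 eq_sym.
have v0 : C - B != 0 by rewrite subr_eq0 eq_sym.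
have w0 : D - C != 0 by rewrite subr_eq0 eq_sym.
rewrite (orthogonal_path_angle_sum erefl erefl erefl u0 v0 w0 uv uw vw).
move: (dot_gt0 u0) (dot_gt0 v0) (dot_gt0 w0).
move: (dot (B - A) (B - A)) (dot (C - B) (C - B)) (dot (D - C) (D - C)).
move=> p q r p0 q0 r0; have [aB sina] := acos_sqrt_ratio p0 q0.
have := acos_sqrt_ratio r0 q0; rewrite (addrC r q) => -[bB sinb].
have := orthoscheme_angle_bounds aB bB.
rewrite sina sinb -sqrtrM; last by rewrite ltW // divr_gt0 // addr_gt0.
lra.
Qed.

(** * Reduction of a path tetrahedron to an orthogonal path *)

Definition vertices : seq 'I_4 := [:: 0; 1; 2; 3].

Definition linked (es : seq ('I_4 * 'I_4)) (i j : 'I_4) : bool :=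
  ((i, j) \in es) || ((j, i) \in es).

Definition star (es : seq ('I_4 * 'I_4)) (i : 'I_4) : bool :=
  all (fun e => (i == e.1) || (i == e.2)) es.

Definition triangle (es : seq ('I_4 * 'I_4)) (i j k : 'I_4) : bool :=
  [&& uniq [:: i; j; k], linked es i j, linked es j k & linked es i k].

Definition edge_path (es : seq ('I_4 * 'I_4)) (i j k l : 'I_4) : bool :=
  [&& uniq [:: i; j; k; l], linked es i j, linked es j k & linked es k l].

Lemma mem_vertices (i : 'I_4) : i \in vertices.
Proof. by case: i => [[|[|[|[|]]]]]. Qed.

(** There are only six edges, hence 216 triples, and the trichotomy is decided by
    evaluation over the explicit list of vertices. *)
Lemma three_edges (e1 e2 e3 : 'I_4 * 'I_4) (es := [:: e1; e2; e3]) :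
  is_edge e1 -> is_edge e2 -> is_edge e3 -> uniq es ->
  [\/ exists i, star es i, exists i j k, triangle es i j k
    | exists i j k l, edge_path es i j k l].
Proof.
pose decided es := uniq es ==> [|| has (star es) vertices,
  has (fun i => has (fun j => has (triangle es i j) vertices) vertices) vertices
  | has (fun i => has (fun j => has (fun k => has (edge_path es i j k)
      vertices) vertices) vertices) vertices].
pose edges := [seq e <- [seq (i, j) | i <- vertices, j <- vertices] | is_edge e].
have mem_edges e : is_edge e -> e \in edges.
  case: e => i j ij; rewrite mem_filter ij.
  by apply: allpairs_f; exact: mem_vertices.
have check : all (fun e1 => all (fun e2 => all (fun e3 =>
    decided [:: e1; e2; e3]) edges) edges) edges by vm_compute.
move=> /mem_edges h1 /mem_edges h2 /mem_edges h3 ues.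
move: check => /allP/(_ _ h1)/allP/(_ _ h2)/allP/(_ _ h3); rewrite /decided ues.
case/or3P.
- by case/hasP => i _ s; apply: Or31; exists i.
- case/hasP => i _ /hasP[j _ /hasP[k _ t]].
  by apply: Or32; exists i, j, k.
- case/hasP => i _ /hasP[j _ /hasP[k _ /hasP[l _ p]]].
  by apply: Or33; exists i, j, k, l.
Qed.

(** If two vertices coincide, the three differences from one of them include the
    zero vector, so the matrix they form is singular and a vector of its left
    kernel is normal to a plane through all four points. *)
Lemma vertices_distinct (R : realType) (T : tetrahedron R) (i j : 'I_4) :
  i != j -> T i != T j.
Proof.
move=> ij; apply/eqP => Tij; apply: (@vertex_noncoplanar R T).
case: (unliftP i j) ij => [m jE _|->]; last by rewrite eqxx.
pose M := \matrix_(a, b) (T (lift i b) - T i) 0 a.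
have /det0P[n n0 nM] : \det M == 0.
  rewrite (expand_det_col _ m) big1 // => a _.
  by rewrite mxE -jE -Tij subrr mxE mul0r.
exists n, (dot n (T i)); split => // k.
case: (unliftP i k) => [b ->|-> //].
have /rowP/(_ b) : n *m M = 0 by [].
rewrite !mxE => nb; apply/eqP; rewrite -subr_eq0 -dotNr -dotDr; apply/eqP.
by rewrite -[RHS]nb; apply: eq_bigr => a _; rewrite [M _ _]mxE.
Qed.

(** Frees orthogonality from the orientation of the edges: reversing an edge only
    changes the sign of an inner product. *)
Lemma linked_orthogonal (R : realType) (T : tetrahedron R)
    (es : seq ('I_4 * 'I_4)) (i j k l : 'I_4) :
  {in es &, forall e f, e != f ->
     dot (edge_vector T e) (edge_vector T f) = 0} ->
  linked es i j -> linked es k l -> (i, j) != (k, l) -> (i, j) != (l, k) ->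
  dot (T j - T i) (T l - T k) = 0.
Proof.
move=> orth /orP[ij|ji] /orP[kl|lk] ne1 ne2.
- exact: (orth _ _ ij kl).
- by rewrite -(opprB (T k)) dotNr (orth _ _ ij lk) ?oppr0.
- rewrite -(opprB (T i)) dotNl (orth _ _ ji kl) ?oppr0 //.
  by apply: contraNN ne2; rewrite !xpair_eqE andbC.
- rewrite -(opprB (T i)) -(opprB (T k)) dotNl dotNr opprK (orth _ _ ji lk) //.
  by apply: contraNN ne1; rewrite !xpair_eqE andbC.
Qed.

(** A star is excluded by the common endpoint, which lies on all three segments;
    a triangle because one of its sides, being the sum of the two others, would
    be orthogonal to itself. *)
Lemma path_tetrahedronP (R : realType) (T : tetrahedron R) :
  path_tetrahedron T ->
  exists i j k l, uniq [:: i; j; k; l] /\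
    [/\ dot (T j - T i) (T k - T j) = 0, dot (T j - T i) (T l - T k) = 0 &
       dot (T k - T j) (T l - T k) = 0].
Proof.
move=> [e1 [e2 [e3 [[E1 E2 E3] [[h12 h13 h23] disj]]]]].
have nonzero e : is_edge e -> dot (edge_vector T e) (edge_vector T e) <> 0.
  move=> lt_e; apply/eqP; rewrite dot_eq0 subr_eq0 vertices_distinct //.
  by rewrite eq_sym -val_eqE ltn_eqF.
have es_uniq : uniq [:: e1; e2; e3].
  rewrite /= !inE negb_or !andbT -andbA; apply/and3P; split.
  - by apply/eqP => e12; case: (nonzero _ E1); rewrite [in X in dot _ X]e12.
  - by apply/eqP => e13; case: (nonzero _ E1); rewrite [in X in dot _ X]e13.
  - by apply/eqP => e23; case: (nonzero _ E2); rewrite [in X in dot _ X]e23.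
have orth : {in [:: e1; e2; e3] &, forall e f, e != f ->
    dot (edge_vector T e) (edge_vector T f) = 0}.
  move=> e f; rewrite !inE => /or3P[]/eqP-> /or3P[]/eqP->; rewrite ?eqxx //.
  - by rewrite dotC.
  - by rewrite dotC.
  - by rewrite dotC.
case: (three_edges E1 E2 E3 es_uniq).
- case=> i /and4P[i1 i2 i3 _].
  have in_edge e : (i == e.1) || (i == e.2) -> edge_segment T e (T i).
    by case/orP => /eqP->; [exists 0 | exists 1]; split;
      rewrite ?lexx ?ler01 ?subr0 ?subrr ?scale1r ?scale0r ?addr0 ?add0r.
  suff : (set0 : set 'rV[R]_3) (T i) by [].
  by rewrite -disj; split; [split|]; exact: in_edge.
- case=> i [j [k /and4P[ijk ij jk ik]]].
  have [nij nik njk] : [/\ i != j, i != k & j != k].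
    by move: ijk; rewrite /= !inE negb_or andbT => /andP[/andP[-> ->] ->].
  have o1 : dot (T j - T i) (T k - T i) = 0.
    apply: (linked_orthogonal orth ij ik);
      by rewrite xpair_eqE ?eqxx ?negb_and ?njk ?nik ?orbT.
  have o2 : dot (T k - T j) (T k - T i) = 0.
    apply: (linked_orthogonal orth jk ik);
      by rewrite xpair_eqE ?negb_and ?njk ?nik ?(eq_sym j i) ?nij
        ?orbT.
  have : dot (T k - T i) (T k - T i) == 0.
    by rewrite -[X in dot X _ ](subrKA (T j)) dotDl o2 o1 addr0.
  by rewrite dot_eq0 subr_eq0 eq_sym (negPf (vertices_distinct _ nik)).
- case=> i [j [k [l /and4P[ijkl ij jk kl]]]]; exists i, j, k, l; split=> //.
  move: ijkl; rewrite /= !inE !negb_or.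
  case/and4P => /and3P[nij nik nil] /andP[njk njl] nkl _; split.
  + apply: (linked_orthogonal orth ij jk);
      by rewrite xpair_eqE negb_and ?nij ?nik.
  + apply: (linked_orthogonal orth ij kl);
      by rewrite xpair_eqE negb_and ?nil ?nik.
  + apply: (linked_orthogonal orth jk kl);
      by rewrite xpair_eqE negb_and ?njk ?njl.
Qed.

Lemma vertex_ind (P : 'I_4 -> Prop) :
  P 0 -> P 1 -> P 2 -> P 3 -> forall i, P i.
Proof.
move=> P0 P1 P2 P3 i; have := mem_vertices i.
by rewrite !inE => /or4P[]/eqP->.
Qed.

(** Bubble sort: each rewriting step removes one inversion from one of the 24
    orderings, so the repetition ends in the increasing one. *)
Lemma adjacent_swaps_invariant (X : Type)
    (F : 'I_4 -> 'I_4 -> 'I_4 -> 'I_4 -> X) :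
  (forall i j k l, F i j k l = F j i k l) ->
  (forall i j k l, F i j k l = F i k j l) ->
  (forall i j k l, F i j k l = F i j l k) ->
  forall i j k l, uniq [:: i; j; k; l] -> F i j k l = F 0 1 2 3.
Proof.
move=> s01 s12 s23 i j k l.
(* Evaluation discards the cases with a repeated vertex. *)
elim/vertex_ind: i; elim/vertex_ind: j; elim/vertex_ind: k;
  elim/vertex_ind: l; (by vm_compute) || (move=> _);
  by repeat first [ rewrite (s01 1 0) | rewrite (s01 2 0) | rewrite (s01 3 0)
    | rewrite (s01 2 1) | rewrite (s01 3 1) | rewrite (s01 3 2)
    | rewrite (s12 _ 1 0) | rewrite (s12 _ 2 0) | rewrite (s12 _ 3 0)
    | rewrite (s12 _ 2 1) | rewrite (s12 _ 3 1) | rewrite (s12 _ 3 2)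
    | rewrite (s23 _ _ 1 0) | rewrite (s23 _ _ 2 0) | rewrite (s23 _ _ 3 0)
    | rewrite (s23 _ _ 2 1) | rewrite (s23 _ _ 3 1) | rewrite (s23 _ _ 3 2)].
Qed.

Lemma dihedral_angle_sum_perm (R : realType) (T : tetrahedron R)
    (i j k l : 'I_4) : uniq [:: i; j; k; l] ->
  dihedral_angle_sum T = angle_sum (T i) (T j) (T k) (T l).
Proof.
pose F i j k l := angle_sum (T i) (T j) (T k) (T l).
move=> ijkl; have -> : dihedral_angle_sum T = F 0 1 2 3 by [].
apply: esym; apply: (adjacent_swaps_invariant (F := F)) ijkl => *.
- exact: angle_sum_swap01.
- exact: angle_sum_swap12.
- exact: angle_sum_swap23.
Qed.

Lemma path_tetrahedron_angle_sum_bounds (R : realType) (T : tetrahedron R) :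
  path_tetrahedron T -> 2 * pi < dihedral_angle_sum T < 5 / 2 * pi.
Proof.
move=> /path_tetrahedronP[i [j [k [l [ijkl [uv uw vw]]]]]].
rewrite (dihedral_angle_sum_perm T ijkl).
move: ijkl; rewrite /= !inE !negb_or.
case/and4P => /and3P[ij _ _] /andP[jk _] kl _.
by apply: orthogonal_path_angle_sum_bounds => //; exact: vertices_distinct.
Qed.

(** * A path tetrahedron with given angle sum *)

Lemma dot_delta (R : realType) (u : 'rV[R]_3) (i : 'I_3) :
  dot u (delta_mx 0 i) = u 0 i.
Proof.
rewrite /dot (bigD1 i) //= big1 ?addr0 => [|j /negPf ji].
  by rewrite mxE !eqxx mulr1.
by rewrite mxE ji andbF mulr0.
Qed.

Definition path_vertices (R : realType) (a b c : R) (i : 'I_4) : 'rV[R]_3 :=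
  let u := a *: delta_mx 0 0 in let v := b *: delta_mx 0 1 in
  let w := c *: delta_mx 0 2 in
  nth 0 [:: 0; u; u + v; u + v + w] i.

(** A normal vector of a plane through these points has zero inner product with
    each of the three legs, hence with the standard basis. *)
Lemma path_vertices_noncoplanar (R : realType) (a b c : R) :
  a != 0 -> b != 0 -> c != 0 -> ~ coplanar (path_vertices a b c).
Proof.
move=> a0 b0 c0 [n [d [/eqP n0 nT]]]; apply: n0; apply/rowP => i.
have := nT 0; have := nT 1; have := nT 2; have := nT 3.
rewrite /path_vertices /= !dot_linear !dot_delta mxE.
have -> : dot n 0 = 0 by rewrite -(scale0r 0) dotZr mul0r.
move=> h3 h2 h1 h0.
have n0 : n 0 0 = 0 by apply: (mulfI a0); lra.
have n1 : n 0 1 = 0 by apply: (mulfI b0); lra.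
have n2 : n 0 2 = 0 by apply: (mulfI c0); lra.
case: i => [[|[|[|//]]]] lt_i.
- by rewrite -[RHS]n0; congr (n 0 _); exact: val_inj.
- by rewrite -[RHS]n1; congr (n 0 _); exact: val_inj.
- by rewrite -[RHS]n2; congr (n 0 _); exact: val_inj.
Qed.

Lemma path_tetrahedron_exists (R : realType) (a b c : R) :
  a != 0 -> b != 0 -> c != 0 ->
  exists T : tetrahedron R, path_tetrahedron T /\ dihedral_angle_sum T =
    3 / 2 * pi + acos (Num.sqrt (b ^+ 2 / (a ^+ 2 + b ^+ 2))) +
    acos (Num.sqrt (b ^+ 2 / (b ^+ 2 + c ^+ 2))) +
    acos (Num.sqrt (a ^+ 2 / (a ^+ 2 + b ^+ 2) *
                    (c ^+ 2 / (b ^+ 2 + c ^+ 2)))).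
Proof.
move=> a0 b0 c0; pose T := Tetrahedron (path_vertices_noncoplanar a0 b0 c0).
pose u : 'rV[R]_3 := a *: delta_mx 0 0.
pose v : 'rV[R]_3 := b *: delta_mx 0 1.
pose w : 'rV[R]_3 := c *: delta_mx 0 2.
have T0 : T 0 = 0 by [].
have T1 : T 1 = u by [].
have T2 : T 2 = u + v by [].
have T3 : T 3 = u + v + w by [].
have Eu : T 1 - T 0 = u by rewrite T1 T0 subr0.
have Ev : T 2 - T 1 = v by rewrite T2 T1 addrC addKr.
have Ew : T 3 - T 2 = w by rewrite T3 T2 addrC addKr.
have uu : dot u u = a ^+ 2 by rewrite !dot_linear dot_delta mxE /= mulr1.
have vv : dot v v = b ^+ 2 by rewrite !dot_linear dot_delta mxE /= mulr1.
have ww : dot w w = c ^+ 2 by rewrite !dot_linear dot_delta mxE /= mulr1.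
have uv : dot u v = 0 by rewrite !dot_linear dot_delta mxE /= !mulr0.
have uw : dot u w = 0 by rewrite !dot_linear dot_delta mxE /= !mulr0.
have vw : dot v w = 0 by rewrite !dot_linear dot_delta mxE /= !mulr0.
have u0 : u != 0 by rewrite -dot_eq0 uu expf_neq0.
have v0 : v != 0 by rewrite -dot_eq0 vv expf_neq0.
have w0 : w != 0 by rewrite -dot_eq0 ww expf_neq0.
clearbody u v w; exists T; split; last first.
  rewrite (dihedral_angle_sum_perm T (i := 0) (j := 1) (k := 2) (l := 3)) //.
  by rewrite (orthogonal_path_angle_sum Eu Ev Ew) // uu vv ww.
exists (0, 1), (1, 2), (2, 3); rewrite /edge_vector /= Eu Ev Ew.
(* A common point would have inner product 0 with v on the first edge and b ^+ 2
   on the third. *)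
split=> //; split=> //; apply/seteqP; split=> // x [[[s [_ sx]] _] [t [_ tx]]].
have {}sx : x = (1 - s) *: 0 + s *: u by rewrite sx -T0 -T1.
have {}tx : x = (1 - t) *: (u + v) + t *: (u + v + w).
  by rewrite tx -T3 -T2.
have : dot x v = b ^+ 2.
  by rewrite tx !dot_linear uv vv (dotC w) vw; ring.
rewrite sx scaler0 add0r dotZl uv mulr0.
by move/esym/eqP; rewrite sqrf_eq0 (negPf b0).
Qed.

(** The equation is used in the form cos (s - 2 t) = sin^2 t, whose two sides are
    continuous on the whole line.  At t = 0 the left side is cos s < 0 and the
    right side 0; at t = s / 2 the left side is 1, larger than the right side.
    For t between these, s - 2 t lies in the range of acos, so applying acos
    recovers the equation. *)
Lemma orthoscheme_angle_attained (R : realType) (s : R) :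
  pi / 2 < s < pi ->
  exists2 t : R, 0 < t < pi / 2 & 2 * t + acos (sin t ^+ 2) = s.
Proof.
move=> /andP[s0 s1]; have pi0 := pi_gt0 R.
pose f (t : R) : R := cos (s - 2 * t) - sin t ^+ 2.
have f0 : f 0 < 0.
  rewrite /f mulr0 subr0 sin0 expr0n subr0 -[s](subrK (pi / 2)).
  by rewrite cosDpihalf oppr_lt0; apply: sin_gt0_pi; lra.
have f1 : 0 < f (s / 2).
  have -> : f (s / 2) = cos (s / 2) ^+ 2.
    by rewrite /f [2 * _]mulrC divfK ?pnatr_eq0 // subrr cos0 -cos2sin2.
  by rewrite exprn_gt0 // cos_gt0_pihalf //; lra.
have fcont : continuous f.
  move=> x.
  apply: (@continuousB R R R (fun t => cos (s - 2 * t)) (fun t => sin t ^+ 2)).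
    apply: (@continuous_comp _ _ _ (fun t : R => s - 2 * t) (@cos R)).
      apply: (@continuousB _ _ _ (fun=> s) (fun t : R => 2 * t)).
        exact: cst_continuous.
      exact: mulrl_continuous.
    exact: continuous_cos.
  apply: (@continuous_comp _ _ _ (@sin R) (fun y => y ^+ 2)).
    exact: continuous_sin.
  exact: exprn_continuous.
have [t] : exists2 t, t \in `[0, s / 2] & f t = 0.
  apply: IVT; [lra | exact: continuous_subspaceT |].
  by rewrite ge_min le_max (ltW f0) (ltW f1) orbT.
rewrite in_itv /= => /andP[t0 t1] ft.
have tn0 : t != 0 by apply/eqP => tE; move: f0; rewrite -[X in f X]tE ft ltxx.
have tn1 : t != s / 2 by apply/eqP => tE; move: f1; rewrite -tE ft ltxx.
have {}t0 : 0 < t by rewrite lt_neqAle eq_sym tn0.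
have {}t1 : t < s / 2 by rewrite lt_neqAle tn1.
exists t; first lra.
have <- : cos (s - 2 * t) = sin t ^+ 2 by apply/eqP; rewrite -subr_eq0 -/(f t) ft.
by rewrite cosK ?in_itv /=; lra.
Qed.

Theorem theorem2 (R : realType) :
  (forall T : tetrahedron R, path_tetrahedron T ->
     2 * pi < dihedral_angle_sum T < 5 / 2 * pi) /\
  (forall s : R, 2 * pi < s < 5 / 2 * pi ->
     exists T : tetrahedron R, path_tetrahedron T /\ dihedral_angle_sum T = s).
Proof.
split=> [|s sB]; first exact: path_tetrahedron_angle_sum_bounds.
have [|t tB ts] := orthoscheme_angle_attained (s := s - 3 / 2 * pi); first lra.
have st := sin_gt0_pihalf tB.
have ct : 0 < cos t by apply: cos_gt0_pihalf; lra.
have [T [pathT sumT]] := path_tetrahedron_exists (lt0r_neq0 st) (lt0r_neq0 ct)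
  (lt0r_neq0 st).
exists T; split=> //; rewrite sumT [sin t ^+ 2 + _]addrC cos2Dsin2 !divr1.
rewrite -expr2 !sqrtr_sqr !ger0_norm ?sqr_ge0 ?ltW //.
rewrite cosK ?in_itv /=; lra.
Qed.
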